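(* Let $s_0,s_3,s_4,s_5,s_6,\pi_1,\pi_2$ be the transformations of the variables $\nu_1,\dots,\nu_8,\kappa_1,\kappa_2,f,g$ (and $q$) defined in the context. (i) Let $\Xi$ be the transformation of the parameters defined by $$(\nu_1,\nu_2,\nu_3,\nu_4,\nu_5,\nu_6,\nu_7,\nu_8;\kappa_1,\kappa_2;f,g)\mapsto\Bigl(\frac{\nu_1\kappa_2}{\nu_5\nu_6\kappa_1^2},\frac{\nu_2\kappa_2}{\nu_5\nu_6\kappa_1^2},\frac{\nu_3\kappa_2}{\nu_5\nu_6\kappa_1^2},\frac{\nu_4\kappa_2}{\nu_5\nu_6\kappa_1^2},\frac{q\nu_5\kappa_1}{\kappa_2},\frac{q\nu_6\kappa_1}{\kappa_2},\frac{\kappa_1}{q\nu_8},\frac{\kappa_1}{q\nu_7};\frac{\kappa_2}{q\nu_5\nu_6\nu_7\nu_8},\frac{\kappa_2}{q\nu_5\nu_6\kappa_1};\frac{f\kappa_2}{\nu_5\nu_6\kappa_1^2},\frac{g\,\nu_5\nu_6\kappa_1^2}{\kappa_2}\Bigr).$$ Let $T$ be the transformation of the parameters defined by $$T=\Xi\cdot(\pi_1\pi_2s_4s_5s_3s_6s_4s_3s_0s_6)^2 .$$ Then $$\frac{(T(f)g-1)(fg-1)}{T(f)f}=\frac{(g-1/\nu_1)(g-1/\nu_2)(g-1/\nu_3)(g-1/\nu_4)}{(g-\nu_5/\kappa_2)(g-\nu_6/\kappa_2)},$$ $$\frac{(T(f)g-1)(T(f)T(g)-1)}{g\,T(g)}=\frac{(T(f)-\nu_1)(T(f)-\nu_2)(T(f)-\nu_3)(T(f)-\nu_4)}{(T(f)-T(\kappa_1/\nu_7))(T(f)-T(\kappa_1/\nu_8))}.$$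 Namely, the operator $T$ represents the time evolution of the $q$-Painlevé equation $q$-$P(E_6^{(1)})$. On the other parameters, $$T(\nu_i)=\nu_i\ (i=1,2,\dots,8),\qquad T(\kappa_1)=\kappa_1/q,\qquad T(\kappa_2)=q\kappa_2 .$$ (ii) For any element $\zeta$ generated by $\nu_1,\nu_2,\nu_3,\nu_4,\nu_5/\kappa_2,\nu_6/\kappa_2,\nu_7/\kappa_1,\nu_8/\kappa_1,f$ and $g$, we have $$\Xi(\zeta)=S_{E_6}\Bigl[\frac{\kappa_2}{\nu_5\nu_6\kappa_1^2}\Bigr](\zeta),$$ where $S_{E_6}[c]$ is the transformation defined in the context.
   Context: **Parameters and conventions.** The quantities $q,\kappa_1,\kappa_2,\nu_1,\dots,\nu_8$ are parameters subject to the relation $\kappa_1^2\kappa_2^2=q\,\nu_1\nu_2\cdots\nu_8$, and $f,g$ are the dependent variables. A transformation is given by the images of the variables and acts on rational expressions by substitution; variables not mentioned are left unchanged. Products are compositions, with the rightmost factor applied first: $(ab)(x)=a(b(x))$. **Transformations (from the extended Weyl group symmetry of type $E_6^{(1)}$).** - $s_0:\ \nu_7\leftrightarrow\nu_8$; $s_3:\ \nu_1\leftrightarrow\nu_2$; $s_4:\ \nu_2\leftrightarrow\nu_3$; $s_5:\ \nu_3\leftrightarrow\nu_4$. - $s_6:\ \nu_1\to\kappa_1/\nu_7,\ \nu_7\to\kappa_1/\nu_1,\ \kappa_2\to\kappa_1\kappa_2/(\nu_1\nu_7),\ g\to g\,\dfrac{\nu_7(\nu_1-f)}{\kappa_1-\nu_7f+(\nu_1\nu_7-\kappa_1)fg}$.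 - $\pi_1:\ q\to1/q,\ \nu_1\to\nu_2/\kappa_2,\ \nu_2\to\nu_1/\kappa_2,\ \nu_3\to1/\nu_6,\ \nu_4\to1/\nu_5,\ \nu_5\to1/\nu_4,\ \nu_6\to1/\nu_3,\ \nu_7\to1/\nu_7,\ \nu_8\to1/\nu_8,\ \kappa_1\to\nu_1\nu_2/(\kappa_1\kappa_2),\ \kappa_2\to1/\kappa_2,\ f\to\dfrac{\nu_1\nu_2(1-fg)}{\kappa_2\{\nu_1\nu_2g+f-(\nu_1+\nu_2)fg\}},\ g\to\kappa_2g$. - $\pi_2:\ q\to1/q,\ \nu_i\to1/\nu_i\ (i=1,2,3,4),\ \nu_5\to1/\nu_8,\ \nu_6\to1/\nu_7,\ \nu_7\to1/\nu_6,\ \nu_8\to1/\nu_5,\ \kappa_1\to1/\kappa_2,\ \kappa_2\to1/\kappa_1,\ f\leftrightarrow g$. **The equation $q$-$P(E_6^{(1)})$.** It is $$\frac{(fg-1)(\overline fg-1)}{f\overline f}=\frac{\prod_{i=1}^4(g-1/\nu_i)}{(g-\nu_5/\kappa_2)(g-\nu_6/\kappa_2)},\qquad\frac{(fg-1)(f\underline g-1)}{g\underline g}=\frac{\prod_{i=1}^4(f-\nu_i)}{(f-\kappa_1/\nu_7)(f-\kappa_1/\nu_8)},$$ where the overline is the time evolution and the underline its inverse, and the parameters evolve by $\overline{\kappa}_1=\kappa_1/q$, $\overline{\kappa}_2=q\kappa_2$, $\overline{\nu}_i=\nu_i$. **The transformation $S_{E_6}[c]$.** For $c\neq0$, $S_{E_6}[c]$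 sends $(\nu_1,\nu_2,\nu_3,\nu_4,\nu_5/\kappa_2,\nu_6/\kappa_2,\nu_7/\kappa_1,\nu_8/\kappa_1,f,g)$ to $(c\nu_1,c\nu_2,c\nu_3,c\nu_4,c^{-1}\nu_5/\kappa_2,c^{-1}\nu_6/\kappa_2,c^{-1}\nu_7/\kappa_1,c^{-1}\nu_8/\kappa_1,cf,c^{-1}g)$.
   Formalization: Ξ is corrected: with c=ν5ν6/κ2, ν_i→cν_i (i≤4), ν5→ν5κ1/(qκ2), ν6→ν6κ1/(qκ2), κ1→κ1²ν5ν6/(qκ2ν7ν8), κ2→κ1ν5ν6/(qκ2), f→cf, g→g/c; (ii) uses S_E6[c] with this c. As printed, T(ν6)≠ν6 and (ii) fails for ν5/κ2. *)

(* Defs.v *)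
From mathcomp Require Import all_boot all_order all_algebra.
From mathcomp Require Import mpoly.

Set Implicit Arguments.
Unset Strict Implicit.
Unset Printing Implicit Defensive.

Import GRing.Theory.
Local Open Scope ring_scope.

(* Since kappa1^2 kappa2^2 = q nu1 ... nu8, the field of rational expressions  *)
(* in q, kappa1, kappa2, nu1, ..., nu8, f, g is purely transcendental over the *)
(* coefficient field k, on the twelve variables other than q. They are kept in *)
(* the order nu1, ..., nu8, kappa1, kappa2, f, g.                              *)
Notation ratfun k := {fraction {mpoly k[12]}}.

Section QPE6.
Variable k : fieldType.
Local Notation K := (ratfun k).

Definition var (i : 'I_12) : K := FracField.tofrac 'X_i.

Definition nu1 : K := var (@Ordinal 12 0 isT).
Definition nu2 : K := var (@Ordinal 12 1 isT).
Definition nu3 : K := var (@Ordinal 12 2 isT).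
Definition nu4 : K := var (@Ordinal 12 3 isT).
Definition nu5 : K := var (@Ordinal 12 4 isT).
Definition nu6 : K := var (@Ordinal 12 5 isT).
Definition nu7 : K := var (@Ordinal 12 6 isT).
Definition nu8 : K := var (@Ordinal 12 7 isT).
Definition kappa1 : K := var (@Ordinal 12 8 isT).
Definition kappa2 : K := var (@Ordinal 12 9 isT).
Definition f : K := var (@Ordinal 12 10 isT).
Definition g : K := var (@Ordinal 12 11 isT).

Definition q : K :=
  kappa1 ^+ 2 * kappa2 ^+ 2 /
  (nu1 * nu2 * nu3 * nu4 * nu5 * nu6 * nu7 * nu8).

(* [subst v r] substitutes v_i for the i-th variable in a numerator and a      *)
(* denominator of r. When the v_i are algebraically independent over k, no     *)
(* denominator is sent to 0 and this is the field endomorphism of K determined *)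
(* by v. This is the case for s0, ..., Xi and for S_E6 xi_scale below.         *)
Definition subst_poly (v : 12.-tuple K) (p : {mpoly k[12]}) : K :=
  mmap (fun a : k => FracField.tofrac a%:MP) (tnth v) p.

Definition subst (v : 12.-tuple K) (r : K) : K :=
  subst_poly v (\n_(repr r)) / subst_poly v (\d_(repr r)).

Definition s0 : K -> K := subst [tuple
  nu1; nu2; nu3; nu4; nu5; nu6; nu8; nu7; kappa1; kappa2; f; g].

Definition s3 : K -> K := subst [tuple
  nu2; nu1; nu3; nu4; nu5; nu6; nu7; nu8; kappa1; kappa2; f; g].

Definition s4 : K -> K := subst [tuple
  nu1; nu3; nu2; nu4; nu5; nu6; nu7; nu8; kappa1; kappa2; f; g].

Definition s5 : K -> K := subst [tuple
  nu1; nu2; nu4; nu3; nu5; nu6; nu7; nu8; kappa1; kappa2; f; g].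

Definition s6 : K -> K := subst [tuple
  kappa1 / nu7; nu2; nu3; nu4; nu5; nu6; kappa1 / nu1; nu8;
  kappa1; kappa1 * kappa2 / (nu1 * nu7);
  f;
  g * (nu7 * (nu1 - f)
       / (kappa1 - nu7 * f + (nu1 * nu7 - kappa1) * f * g))].

(* q -> 1/q under pi1 and pi2 is a consequence of the definition of q.         *)
Definition pi1 : K -> K := subst [tuple
  nu2 / kappa2; nu1 / kappa2; 1 / nu6; 1 / nu5; 1 / nu4; 1 / nu3;
  1 / nu7; 1 / nu8;
  nu1 * nu2 / (kappa1 * kappa2); 1 / kappa2;
  nu1 * nu2 * (1 - f * g)
    / (kappa2 * (nu1 * nu2 * g + f - (nu1 + nu2) * f * g));
  kappa2 * g].

Definition pi2 : K -> K := subst [tuple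
  1 / nu1; 1 / nu2; 1 / nu3; 1 / nu4; 1 / nu8; 1 / nu7; 1 / nu6; 1 / nu5;
  1 / kappa2; 1 / kappa1; g; f].

(* The source of these formulas prints kappa2 / (nu5 nu6 kappa1^2) instead of  *)
(* xi_scale, and                                                               *)
(*   nu5 -> q nu5 kappa1 / kappa2,        nu6 -> q nu6 kappa1 / kappa2,        *)
(*   kappa1 -> kappa2 / (q nu5 nu6 nu7 nu8),                                   *)
(*   kappa2 -> kappa2 / (q nu5 nu6 kappa1)                                     *)
(* in Xi. That cannot be meant: it sends q to q^-3, and, as w (w nu6) is       *)
(* kappa2 / nu5, it does not give T nu6 = nu6. The images of the parameters    *)
(* under Xi below are the only ones for which T fixes every nu_i and maps      *)
(* kappa1 to kappa1 / q and kappa2 to q kappa2.                                *)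
Definition xi_scale : K := nu5 * nu6 / kappa2.

Definition Xi : K -> K := subst [tuple
  nu1 * xi_scale; nu2 * xi_scale; nu3 * xi_scale; nu4 * xi_scale;
  nu5 * kappa1 / (q * kappa2); nu6 * kappa1 / (q * kappa2);
  kappa1 / (q * nu8); kappa1 / (q * nu7);
  kappa1 ^+ 2 * nu5 * nu6 / (q * kappa2 * nu7 * nu8);
  kappa1 * nu5 * nu6 / (q * kappa2);
  f * xi_scale; g / xi_scale].

Definition w : K -> K :=
  pi1 \o pi2 \o s4 \o s5 \o s3 \o s6 \o s4 \o s3 \o s0 \o s6.

Definition T : K -> K := Xi \o w \o w.

(* S_E6[c] is only prescribed on the subfield generated by E6_generators; it   *)
(* is extended by fixing kappa1 and kappa2. The scalar c is not substituted.   *)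
Definition S_E6 (c : K) : K -> K := subst [tuple
  c * nu1; c * nu2; c * nu3; c * nu4;
  c^-1 * nu5; c^-1 * nu6; c^-1 * nu7; c^-1 * nu8;
  kappa1; kappa2; c * f; c^-1 * g].

Definition E6_generators : seq K :=
  [:: nu1; nu2; nu3; nu4; nu5 / kappa2; nu6 / kappa2;
      nu7 / kappa1; nu8 / kappa1; f; g].

Inductive generated (G : seq K) : K -> Prop :=
| generated_const (a : k) : generated G (FracField.tofrac a%:MP)
| generated_mem x : x \in G -> generated G x
| generated_add x y : generated G x -> generated G y -> generated G (x + y)
| generated_opp x : generated G x -> generated G (- x)
| generated_mul x y : generated G x -> generated G y -> generated G (x * y)
| generated_inv x : generated G x -> generated G x^-1.

End QPE6.

Arguments nu1 {k}.
Arguments nu2 {k}.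
Arguments nu3 {k}.
Arguments nu4 {k}.
Arguments nu5 {k}.
Arguments nu6 {k}.
Arguments nu7 {k}.
Arguments nu8 {k}.
Arguments kappa1 {k}.
Arguments kappa2 {k}.
Arguments f {k}.
Arguments g {k}.
Arguments q {k}.
Arguments xi_scale {k}.
Arguments E6_generators {k}.

(* Main.v *)
(* Write G = g / (fg - 1) and F = f / (fg - 1), so that 1/g = f - 1/G. In these   *)
(* coordinates the generators act by multiplication: s6 sends G to                *)
(* G (f - nu1) / (f - kappa1/nu7), pi2 exchanges F and G, and pi1 sends F to      *)
(* 1 / (kappa2 F (g - 1/nu1) (g - 1/nu2)). Hence w f = kappa2 g and               *)
(* 1 / w g = kappa2 (g - A), where A is the first right-hand side multiplied by F.*)
(* As Xi rescales A like g, T = Xi w w satisfies 1 / T f = g - A, which is the    *)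
(* first equation, and applying Xi w to 1 / w g gives the second one.             *)
(* A substitution is a field endomorphism as soon as some other substitution      *)
(* undoes it on the variables, which here holds with explicit inverses.           *)
Require Import Defs.
From HB Require Import structures.
From mathcomp Require Import all_boot all_order all_algebra.
From mathcomp Require Import mpoly ring.

Set Implicit Arguments.
Unset Strict Implicit.
Unset Printing Implicit Defensive.

Import GRing.Theory.
Local Open Scope ring_scope.

(** Both equations are images of one identity. [half_step_G] says that w sends 1/G to kappa2 A,
    whence 1/w(g) = kappa2 (g - A) in [half_step_Vg]. As w f = kappa2 g, T f is b Xi(w g) with b =
    Xi(w kappa2), so applying Xi to the identity gives 1/T f = g - A ([evolution_Vf], using [Xi_A]),
    and applying Xi w gives 1/T g ([evolution_g]). For (ii), [Xi_scaling] checks the generators, and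
    [generated_agree] extends the agreement to the subfield they generate.

    These computations are made in any field with twelve elements satisfying [generic_coordinates],
    for abstract field endomorphisms. Two facts transfer them to rational functions. The
    denominators are nonzero because they remain so at f = 0 or g = 0 ([specializations_generic]).
    Each substitution is a field endomorphism because it kills no nonzero polynomial: another
    substitution undoes it ([mmap_inj]). To avoid a circular argument, that other substitution is
    used only as a partial morphism, the relation [specializes]. *)

(** * Partial field morphisms *)

(* [P x x'] reads: [x] is in the domain (a local ring) of a partial morphism and  *)
(* is mapped to [x'].                                                             *)
Record partial_morphism (F F' : fieldType) (P : F -> F' -> Prop) : Prop := {
  partial1 : P 1 1;
  partialB x x' y y' : P x x' -> P y y' -> P (x - y) (x' - y');
  partialM x x' y y' : P x x' -> P y y' -> P (x * y) (x' * y');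
  partialV x x' : P x x' -> x' != 0 -> P x^-1 x'^-1;
  partial_inj0 x' : P 0 x' -> x' = 0 }.

Section PartialMorphismTheory.
Variables (F F' : fieldType) (P : F -> F' -> Prop).
Hypothesis pP : partial_morphism P.

Lemma partial0 : P 0 0.
Proof.
rewrite -(subrr 1) -[X in P _ X](subrr 1).
by apply: (partialB pP); apply: (partial1 pP).
Qed.

Lemma partialN x x' : P x x' -> P (- x) (- x').
Proof.
move=> Px; rewrite -sub0r -[- x']sub0r.
by apply: (partialB pP) => //; apply: partial0.
Qed.

Lemma partialD x x' y y' : P x x' -> P y y' -> P (x + y) (x' + y').
Proof.
move=> Px Py; rewrite -[y]opprK -[y']opprK.
by apply: (partialB pP) => //; apply: partialN.
Qed.

Lemma partialX x x' m : P x x' -> P (x ^+ m) (x' ^+ m).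
Proof.
move=> Px; elim: m => [|m IHm]; first exact: (partial1 pP).
by rewrite !exprS; apply: (partialM pP).
Qed.

(** Nonvanishing can be tested after specialization. *)
Lemma partial_neq0 x x' : P x x' -> x' != 0 -> x != 0.
Proof.
by move=> Px; apply: contraNneq => x0; apply/eqP/(partial_inj0 pP); rewrite -x0.
Qed.

Lemma partial_fun x x' x'' : P x x' -> P x x'' -> x' = x''.
Proof.
move=> Px' Px''; apply/eqP; rewrite -subr_eq0; apply/eqP/(partial_inj0 pP).
by rewrite -(subrr x); apply: (partialB pP).
Qed.

Lemma partial_eq x x' x'' : P x x' -> x' = x'' -> P x x''.
Proof. by move=> Px <-. Qed.

End PartialMorphismTheory.

(** * Extension of a ring morphism to fractions *)

Section FractionMap.
Variables (R : idomainType) (F : fieldType) (phi : {rmorphism R -> F}).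
Local Notation "x %:F" := (FracField.tofrac x).

(** The domain is the localization of [R] at the kernel of [phi]. The kernel may be nonzero, which
    allows setting a variable to 0. *)
Definition specializes (r : {fraction R}) (x : F) : Prop :=
  exists n d, [/\ r = n%:F / d%:F, phi d != 0 & x = phi n / phi d].

Lemma specializes_tofrac p x : phi p = x -> specializes p%:F x.
Proof.
by move=> <-; exists p, 1; rewrite !rmorph1 !divr1; split; rewrite ?oner_neq0.
Qed.

Let nzF d : phi d != 0 -> d%:F != 0 :> {fraction R}.
Proof. by apply: contraNneq => /eqP; rewrite tofrac_eq0 => /eqP->; rewrite rmorph0. Qed.

Lemma specializes_partial : partial_morphism specializes.
Proof.
split.
- by rewrite -(rmorph1 (@FracField.tofrac R)); apply/specializes_tofrac/rmorph1.
- move=> _ _ _ _ [n [d [-> dN0 ->]]] [m [e [-> eN0 ->]]].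
  exists (n * e - m * d), (d * e); split.
  + by rewrite -mulNr addf_div ?nzF // tofracB !tofracM mulNr.
  + by rewrite rmorphM mulf_neq0.
  + by rewrite -mulNr addf_div // rmorphB !rmorphM mulNr.
- move=> _ _ _ _ [n [d [-> dN0 ->]]] [m [e [-> eN0 ->]]].
  exists (n * m), (d * e); split.
  + by rewrite mulf_div !tofracM.
  + by rewrite rmorphM mulf_neq0.
  + by rewrite mulf_div !rmorphM.
- move=> _ _ [n [d [-> dN0 ->]]] xN0; exists d, n; rewrite !invf_div; split=> //.
  by apply: contraNneq xN0 => ->; rewrite mul0r.
- move=> x' [n [d [/esym/eqP]]]; rewrite mulf_eq0 invr_eq0.
  move=> + dN0 ->; rewrite (negPf (nzF dN0)) orbF tofrac_eq0 => /eqP->.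
  by rewrite rmorph0 mul0r.
Qed.

Definition fraction_map (r : {fraction R}) : F :=
  phi \n_(repr r) / phi \d_(repr r).

Lemma fraction_numer_denom (r : {fraction R}) :
  r = (\n_(repr r))%:F / (\d_(repr r))%:F.
Proof.
apply: (canRL (mulfK _)); first by rewrite tofrac_eq0 denom_ratioP.
move: (reprK r); move: (repr r) => s <-; unlock FracField.tofrac.
rewrite -[LHS]FracField.pi_mul; apply/eqmodP.
rewrite /= /FracField.equivf /FracField.mulf.
by rewrite !numden_Ratio ?mulf_neq0 ?oner_neq0 ?denom_ratioP // !mulr1 mulrC.
Qed.

Hypothesis phi_inj : forall p, phi p = 0 -> p = 0.

Lemma fraction_map_specializes r : specializes r (fraction_map r).
Proof.
exists \n_(repr r), \d_(repr r); split=> //; first exact: fraction_numer_denom.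
by apply: contra_neq (denom_ratioP (repr r)); apply: phi_inj.
Qed.

(** As [specializes] is functional, any representation of [r] may be used, not only the one chosen
    by [repr]. *)
Lemma fraction_mapE r x : specializes r x -> fraction_map r = x.
Proof. exact/partial_fun/fraction_map_specializes/specializes_partial. Qed.

Lemma fraction_map_is_zmod_morphism : zmod_morphism fraction_map.
Proof.
by move=> r s; apply/fraction_mapE/(partialB specializes_partial);
  apply: fraction_map_specializes.
Qed.

Lemma fraction_map_is_monoid_morphism : monoid_morphism fraction_map.
Proof.
split=> [|r s]; apply/fraction_mapE; first exact: (partial1 specializes_partial).
by apply: (partialM specializes_partial); apply: fraction_map_specializes.
Qed.

End FractionMap.

(** * Substitution in polynomials *)

Lemma mmap_partial n (k F F' : fieldType) (P : F -> F' -> Prop)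
    (h : k -> F) (h' : k -> F') (v : 'I_n -> F) (v' : 'I_n -> F') :
  partial_morphism P -> (forall a, P (h a) (h' a)) -> (forall i, P (v i) (v' i)) ->
  forall p, P (mmap h v p) (mmap h' v' p).
Proof.
move=> pP Ph Pv p; apply: (big_ind2 P) => [|x x' y y'|m _].
- exact: partial0.
- exact: partialD.
apply: (partialM pP) => //; apply: (big_ind2 P) => [|x x' y y'|i _].
- exact: (partial1 pP).
- exact: (partialM pP).
- exact: partialX.
Qed.

Lemma mmap_var n (k F : fieldType) (iota : {rmorphism {mpoly k[n]} -> F}) p :
  mmap (fun a => iota a%:MP) (fun i => iota 'X_i) p = iota p.
Proof.
rewrite [in RHS](mpolyE p) rmorph_sum; apply: eq_bigr => m _.
rewrite -mul_mpolyC rmorphM mpolyXE_id rmorph_prod; congr (_ * _).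
by apply: eq_bigr => i _; rewrite rmorphXn.
Qed.

(** [P] plays the inverse substitution: it carries the value of [p] at [v] back to [iota p], and
    carries 0 only to 0. *)
Lemma mmap_inj n (k F : fieldType) (iota : {rmorphism {mpoly k[n]} -> F})
    (P : F -> F -> Prop) (v : 'I_n -> F) :
  (forall p, iota p = 0 -> p = 0) -> partial_morphism P ->
  (forall a, P (iota a%:MP) (iota a%:MP)) -> (forall i, P (v i) (iota 'X_i)) ->
  forall p, mmap (fun a => iota a%:MP) v p = 0 -> p = 0.
Proof.
move=> iota_inj pP Pc Pv p vp0; apply/iota_inj/(partial_inj0 pP).
by rewrite -vp0 -(mmap_var iota p); apply: mmap_partial.
Qed.

(** * The coordinates and their nonvanishing *)

Section TwelveCoordinates.
Variables (S S' : Type) (Q : S -> S' -> Prop).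
Variables (x0 x1 x2 x3 x4 x5 x6 x7 x8 x9 x10 x11 : S).
Variables (y0 y1 y2 y3 y4 y5 y6 y7 y8 y9 y10 y11 : S').
Let X := [tuple x0; x1; x2; x3; x4; x5; x6; x7; x8; x9; x10; x11].
Let Y := [tuple y0; y1; y2; y3; y4; y5; y6; y7; y8; y9; y10; y11].

Lemma coordinates_elim :
  (forall i, Q (tnth X i) (tnth Y i)) ->
  [/\ [/\ Q x0 y0, Q x1 y1, Q x2 y2 & Q x3 y3],
      [/\ Q x4 y4, Q x5 y5, Q x6 y6 & Q x7 y7]
    & [/\ Q x8 y8, Q x9 y9, Q x10 y10 & Q x11 y11]].
Proof.
move=> XY; split; split.
- exact: (XY (@Ordinal 12 0 isT)).
- exact: (XY (@Ordinal 12 1 isT)).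
- exact: (XY (@Ordinal 12 2 isT)).
- exact: (XY (@Ordinal 12 3 isT)).
- exact: (XY (@Ordinal 12 4 isT)).
- exact: (XY (@Ordinal 12 5 isT)).
- exact: (XY (@Ordinal 12 6 isT)).
- exact: (XY (@Ordinal 12 7 isT)).
- exact: (XY (@Ordinal 12 8 isT)).
- exact: (XY (@Ordinal 12 9 isT)).
- exact: (XY (@Ordinal 12 10 isT)).
- exact: (XY (@Ordinal 12 11 isT)).
Qed.

Lemma coordinates_intro :
  [/\ [/\ Q x0 y0, Q x1 y1, Q x2 y2 & Q x3 y3],
      [/\ Q x4 y4, Q x5 y5, Q x6 y6 & Q x7 y7]
    & [/\ Q x8 y8, Q x9 y9, Q x10 y10 & Q x11 y11]] ->
  forall i, Q (tnth X i) (tnth Y i).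
Proof.
case=> [[? ? ? ?] [? ? ? ?] [? ? ? ?]] [m lt_m12].
by do 12?[case: m lt_m12 => [|m] lt_m12 //].
Qed.

End TwelveCoordinates.

(** Computes an image under [P] along the structure of the expression. What remains is its
    comparison with the expected image and a nonvanishing goal for each inversion. *)
Ltac partial_image pP :=
  refine (partial_eq _ _); [
    repeat first [ eassumption | apply: (partial1 pP) | apply: (partialM pP)
                 | apply: (partialV pP) | apply: (partialX pP)
                 | apply: (partialB pP) | apply: (partialN pP)
                 | apply: (partialD pP) ] | ].

Ltac nonzero :=
  rewrite ?(mulf_eq0, invr_eq0, oppr_eq0, oner_eq0, expf_eq0) ?negb_or /=;
  by repeat (apply/andP; split).

Ltac coordinatewise pP PX :=
  have [[? ? ? ?] [? ? ? ?] [? ? ? ?]] := coordinates_elim PX;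
  apply: coordinates_intro; do 2!split; partial_image pP; try nonzero.

(* The factors that occur in denominators along the computation of T.             *)
Record generic_coordinates (F : fieldType)
    (n1 n2 n3 n4 n5 n6 n7 n8 k1 k2 f g : F) : Prop := GenericCoordinates {
  generic_nu : [/\ [/\ n1 != 0, n2 != 0, n3 != 0 & n4 != 0],
                   [/\ n5 != 0, n6 != 0, n7 != 0 & n8 != 0]
                 & [/\ k1 != 0, k2 != 0, f != 0 & g != 0]];
  generic_fg : f * g - 1 != 0;
  generic_s6 : k1 - n7 * f + (n1 * n7 - k1) * f * g != 0;
  generic_pi1 : n1 * n2 * g + f - (n1 + n2) * f * g != 0;
  generic_n1f : n1 - f != 0;
  generic_n7f : k1 - n7 * f != 0;
  generic_ng : [/\ 1 - n1 * g != 0, 1 - n2 * g != 0,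
                   1 - n3 * g != 0 & 1 - n4 * g != 0];
  generic_kg : n5 - k2 * g != 0 /\ n6 - k2 * g != 0 }.

(** At f = 0 or at g = 0, every factor that is not already a variable reduces to 1, to -1 or to a
    single variable. *)
Lemma specializations_generic (F : fieldType)
    (n1 n2 n3 n4 n5 n6 n7 n8 k1 k2 f g : F) (Pf Pg : F -> F -> Prop) :
  let X := [tuple n1; n2; n3; n4; n5; n6; n7; n8; k1; k2; f; g] in
  (forall i, tnth X i != 0) -> partial_morphism Pf -> partial_morphism Pg ->
  (forall i, Pf (tnth X i)
     (tnth [tuple n1; n2; n3; n4; n5; n6; n7; n8; k1; k2; 0; g] i)) ->
  (forall i, Pg (tnth X i)
     (tnth [tuple n1; n2; n3; n4; n5; n6; n7; n8; k1; k2; f; 0] i)) ->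
  generic_coordinates n1 n2 n3 n4 n5 n6 n7 n8 k1 k2 f g.
Proof.
move=> X X_neq0 pPf pPg Pf_X Pg_X.
have XN0 := @coordinates_elim _ _ (fun x _ : F => x != 0)
  _ _ _ _ _ _ _ _ _ _ _ _ n1 n2 n3 n4 n5 n6 n7 n8 k1 k2 f g X_neq0.
have [[n1N0 ? ? ?] [n5N0 n6N0 ? ?] [k1N0 ? fN0 ?]] := XN0.
have N1N0 : - 1 != 0 :> F by rewrite oppr_eq0 oner_neq0.
have [[? ? ? ?] [? ? ? ?] [? ? ? ?]] := coordinates_elim Pf_X.
have [[? ? ? ?] [? ? ? ?] [? ? ? ?]] := coordinates_elim Pg_X.
split=> //; [..|split|split].
- by apply: (partial_neq0 pPf _ N1N0); partial_image pPf; ring.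
- by apply: (partial_neq0 pPf _ k1N0); partial_image pPf; ring.
- by apply: (partial_neq0 pPg _ fN0); partial_image pPg; ring.
- by apply: (partial_neq0 pPf _ n1N0); partial_image pPf; ring.
- by apply: (partial_neq0 pPf _ k1N0); partial_image pPf; ring.
- by apply: (partial_neq0 pPg _ (oner_neq0 F)); partial_image pPg; ring.
- by apply: (partial_neq0 pPg _ (oner_neq0 F)); partial_image pPg; ring.
- by apply: (partial_neq0 pPg _ (oner_neq0 F)); partial_image pPg; ring.
- by apply: (partial_neq0 pPg _ (oner_neq0 F)); partial_image pPg; ring.
- by apply: (partial_neq0 pPg _ n5N0); partial_image pPg; ring.
- by apply: (partial_neq0 pPg _ n6N0); partial_image pPg; ring.
Qed.

Section Coordinates.

Variables (F : fieldType) (n1 n2 n3 n4 n5 n6 n7 n8 k1 k2 f g : F).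
Hypothesis generic : generic_coordinates n1 n2 n3 n4 n5 n6 n7 n8 k1 k2 f g.

Let X := [tuple n1; n2; n3; n4; n5; n6; n7; n8; k1; k2; f; g].
Let D6 := k1 - n7 * f + (n1 * n7 - k1) * f * g.
Let D1 := n1 * n2 * g + f - (n1 + n2) * f * g.
Let q := k1 ^+ 2 * k2 ^+ 2 / (n1 * n2 * n3 * n4 * n5 * n6 * n7 * n8).
Let s := n5 * n6 / k2.

Let n1N0 : n1 != 0. Proof. by have [[[]]] := generic. Qed.
Let n2N0 : n2 != 0. Proof. by have [[[]]] := generic. Qed.
Let n3N0 : n3 != 0. Proof. by have [[[]]] := generic. Qed.
Let n4N0 : n4 != 0. Proof. by have [[[]]] := generic. Qed.
Let n5N0 : n5 != 0. Proof. by have [[_ []]] := generic. Qed.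
Let n6N0 : n6 != 0. Proof. by have [[_ []]] := generic. Qed.
Let n7N0 : n7 != 0. Proof. by have [[_ []]] := generic. Qed.
Let n8N0 : n8 != 0. Proof. by have [[_ []]] := generic. Qed.
Let k1N0 : k1 != 0. Proof. by have [[_ _ []]] := generic. Qed.
Let k2N0 : k2 != 0. Proof. by have [[_ _ []]] := generic. Qed.
Let fN0 : f != 0. Proof. by have [[_ _ []]] := generic. Qed.
Let gN0 : g != 0. Proof. by have [[_ _ []]] := generic. Qed.
Let fg1 : f * g - 1 != 0 := generic_fg generic.
Let D6N0 : D6 != 0 := generic_s6 generic.
Let D1N0 : D1 != 0 := generic_pi1 generic.
Let n1f : n1 - f != 0 := generic_n1f generic.
Let n7f : k1 - n7 * f != 0 := generic_n7f generic.
Let n1g : 1 - n1 * g != 0. Proof. by have [] := generic_ng generic. Qed.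
Let n2g : 1 - n2 * g != 0. Proof. by have [] := generic_ng generic. Qed.
Let n3g : 1 - n3 * g != 0. Proof. by have [] := generic_ng generic. Qed.
Let n4g : 1 - n4 * g != 0. Proof. by have [] := generic_ng generic. Qed.
Let n5g : n5 - k2 * g != 0. Proof. by have [] := generic_kg generic. Qed.
Let n6g : n6 - k2 * g != 0. Proof. by have [] := generic_kg generic. Qed.
Let qN0 : q != 0. Proof. by rewrite /q; nonzero. Qed.
Let sN0 : s != 0. Proof. by rewrite /s; nonzero. Qed.

(** * Inverse substitutions *)

Section Inverses.

Variable P : F -> F -> Prop.
Hypothesis pP : partial_morphism P.

(** In the involution lemmas the hypothesis makes [P] the substitution of [V] for the variables;
    applied to [V] itself, it gives the variables back. *)
Lemma s0_involution :
  let V := [tuple n1; n2; n3; n4; n5; n6; n8; n7; k1; k2; f; g] in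
  (forall i, P (tnth X i) (tnth V i)) -> forall i, P (tnth V i) (tnth X i).
Proof. by move=> V PX; coordinatewise pP PX. Qed.

Lemma s3_involution :
  let V := [tuple n2; n1; n3; n4; n5; n6; n7; n8; k1; k2; f; g] in
  (forall i, P (tnth X i) (tnth V i)) -> forall i, P (tnth V i) (tnth X i).
Proof. by move=> V PX; coordinatewise pP PX. Qed.

Lemma s4_involution :
  let V := [tuple n1; n3; n2; n4; n5; n6; n7; n8; k1; k2; f; g] in
  (forall i, P (tnth X i) (tnth V i)) -> forall i, P (tnth V i) (tnth X i).
Proof. by move=> V PX; coordinatewise pP PX. Qed.

Lemma s5_involution :
  let V := [tuple n1; n2; n4; n3; n5; n6; n7; n8; k1; k2; f; g] in
  (forall i, P (tnth X i) (tnth V i)) -> forall i, P (tnth V i) (tnth X i).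
Proof. by move=> V PX; coordinatewise pP PX. Qed.

Lemma s6_involution :
  let V := [tuple k1 / n7; n2; n3; n4; n5; n6; k1 / n1; n8;
    k1; k1 * k2 / (n1 * n7); f; g * (n7 * (n1 - f) / D6)] in
  (forall i, P (tnth X i) (tnth V i)) -> forall i, P (tnth V i) (tnth X i).
Proof.
move=> V PX.
(* The image of [D6] has to be inverted; in factored form it is visibly nonzero. *)
have D6E : k1 - k1 / n1 * f +
    (k1 / n7 * (k1 / n1) - k1) * f * (g * (n7 * (n1 - f) / D6))
    = k1 * (n1 - f) * (k1 - n7 * f) / (n1 * D6).
  by rewrite /D6; field; nonzero.
coordinatewise pP PX; rewrite ?D6E; try nonzero.
all: by field; nonzero.
Qed.

Lemma pi1_involution :
  let V := [tuple n2 / k2; n1 / k2; 1 / n6; 1 / n5; 1 / n4; 1 / n3;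
    1 / n7; 1 / n8; n1 * n2 / (k1 * k2); 1 / k2;
    n1 * n2 * (1 - f * g) / (k2 * D1); k2 * g] in
  (forall i, P (tnth X i) (tnth V i)) -> forall i, P (tnth V i) (tnth X i).
Proof.
move=> V PX.
have D1E : n2 / k2 * (n1 / k2) * (k2 * g) + n1 * n2 * (1 - f * g) / (k2 * D1) -
    (n2 / k2 + n1 / k2) * (n1 * n2 * (1 - f * g) / (k2 * D1)) * (k2 * g)
    = n1 * n2 * (1 - n1 * g) * (1 - n2 * g) / (k2 * D1).
  by rewrite /D1; field; nonzero.
coordinatewise pP PX; rewrite ?D1E; try nonzero.
all: by rewrite ?/D1; field; nonzero.
Qed.

Lemma pi2_involution :
  let V := [tuple 1 / n1; 1 / n2; 1 / n3; 1 / n4; 1 / n8; 1 / n7; 1 / n6;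
    1 / n5; 1 / k2; 1 / k1; g; f] in
  (forall i, P (tnth X i) (tnth V i)) -> forall i, P (tnth V i) (tnth X i).
Proof. by move=> V PX; coordinatewise pP PX; field; nonzero. Qed.

(** The scale of the inverse of Xi. That inverse fixes [q] and sends [s] to 1/t, so the two
    rescalings cancel. *)
Let t := k1 * k2 ^+ 2 / (n1 * n2 * n3 * n4 * n5 * n6).

Lemma Xi_inverse :
  let V := [tuple n1 * s; n2 * s; n3 * s; n4 * s;
    n5 * k1 / (q * k2); n6 * k1 / (q * k2); k1 / (q * n8); k1 / (q * n7);
    k1 ^+ 2 * n5 * n6 / (q * k2 * n7 * n8); k1 * n5 * n6 / (q * k2);
    f * s; g / s] in
  let V' := [tuple n1 * t; n2 * t; n3 * t; n4 * t; k2 / n6; k2 / n5;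
    t * k2 / n8; t * k2 / n7; q * t * k2; t * k2 ^+ 2 / (n5 * n6);
    f * t; g / t] in
  (forall i, P (tnth X i) (tnth V' i)) -> forall i, P (tnth V i) (tnth X i).
Proof.
move=> V V' PX.
have [[? ? ? ?] [? ? ? ?] [? ? ? ?]] := coordinates_elim PX.
have tN0 : t != 0 by rewrite /t; nonzero.
have Pq : P q q.
  by rewrite {1}/q; partial_image pP; try nonzero; rewrite /q /t; field; nonzero.
have Ps : P s t^-1.
  by rewrite {1}/s; partial_image pP; try nonzero; field; nonzero.
apply: coordinates_intro; do 2!split; partial_image pP; try nonzero.
all: by [field; nonzero | rewrite /t /q; field; nonzero].
Qed.

(** The scaling multiplies [s] by s^-2, hence sends it to s^-1, and the second application cancels
    the first. *)
Lemma S_E6_involution :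
  let V := [tuple s * n1; s * n2; s * n3; s * n4; s^-1 * n5; s^-1 * n6;
    s^-1 * n7; s^-1 * n8; k1; k2; s * f; s^-1 * g] in
  (forall i, P (tnth X i) (tnth V i)) -> forall i, P (tnth V i) (tnth X i).
Proof.
by move=> V PX; rewrite /V /s; coordinatewise pP PX; rewrite /s; field; nonzero.
Qed.

End Inverses.

(** * The operators w and T *)

Section Evolution.

Variables s0 s3 s4 s5 s6 pi1 pi2 Xi : {rmorphism F -> F}.
Hypothesis s0_X : forall i, s0 (tnth X i) = tnth
  [tuple n1; n2; n3; n4; n5; n6; n8; n7; k1; k2; f; g] i.
Hypothesis s3_X : forall i, s3 (tnth X i) = tnth
  [tuple n2; n1; n3; n4; n5; n6; n7; n8; k1; k2; f; g] i.
Hypothesis s4_X : forall i, s4 (tnth X i) = tnth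
  [tuple n1; n3; n2; n4; n5; n6; n7; n8; k1; k2; f; g] i.
Hypothesis s5_X : forall i, s5 (tnth X i) = tnth
  [tuple n1; n2; n4; n3; n5; n6; n7; n8; k1; k2; f; g] i.
Hypothesis s6_X : forall i, s6 (tnth X i) = tnth
  [tuple k1 / n7; n2; n3; n4; n5; n6; k1 / n1; n8;
    k1; k1 * k2 / (n1 * n7); f; g * (n7 * (n1 - f) / D6)] i.
Hypothesis pi1_X : forall i, pi1 (tnth X i) = tnth
  [tuple n2 / k2; n1 / k2; 1 / n6; 1 / n5; 1 / n4; 1 / n3;
    1 / n7; 1 / n8; n1 * n2 / (k1 * k2); 1 / k2;
    n1 * n2 * (1 - f * g) / (k2 * D1); k2 * g] i.
Hypothesis pi2_X : forall i, pi2 (tnth X i) = tnth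
  [tuple 1 / n1; 1 / n2; 1 / n3; 1 / n4; 1 / n8; 1 / n7; 1 / n6;
    1 / n5; 1 / k2; 1 / k1; g; f] i.
Hypothesis Xi_X : forall i, Xi (tnth X i) = tnth
  [tuple n1 * s; n2 * s; n3 * s; n4 * s;
    n5 * k1 / (q * k2); n6 * k1 / (q * k2); k1 / (q * n8); k1 / (q * n7);
    k1 ^+ 2 * n5 * n6 / (q * k2 * n7 * n8); k1 * n5 * n6 / (q * k2);
    f * s; g / s] i.

Lemma images (phi : F -> F) v1 v2 v3 v4 v5 v6 v7 v8 v9 v10 v11 v12 :
  (forall i, phi (tnth X i) =
    tnth [tuple v1; v2; v3; v4; v5; v6; v7; v8; v9; v10; v11; v12] i) ->
  (((phi n1 = v1) * (phi n2 = v2) * (phi n3 = v3) * (phi n4 = v4)) *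
   ((phi n5 = v5) * (phi n6 = v6) * (phi n7 = v7) * (phi n8 = v8)) *
   ((phi k1 = v9) * (phi k2 = v10) * (phi f = v11) * (phi g = v12)))%type.
Proof.
move/(coordinates_elim (Q := fun x y => phi x = y)).
by case=> [[-> -> -> ->] [-> -> -> ->] [-> -> -> ->]].
Qed.

Let s0E := images s0_X.
Let s3E := images s3_X.
Let s4E := images s4_X.
Let s5E := images s5_X.
Let s6E := images s6_X.
Let pi1E := images pi1_X.
Let pi2E := images pi2_X.
Let XiE := images Xi_X.
Let rmE := (rmorphM, rmorphB, rmorphN, rmorph1, fmorphV).

Let G := g / (f * g - 1).
Let Fg := f / (f * g - 1).

(** [D6] divides both the image of [g] and that of f g - 1, and cancels in the quotient. *)
Lemma s6_G : s6 G = G * (n7 * (n1 - f) / (k1 - n7 * f)).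
Proof.
rewrite /G !rmE !s6E.
have -> : f * (g * (n7 * (n1 - f) / D6)) - 1 = (f * g - 1) * (k1 - n7 * f) / D6.
  by rewrite /D6; field; nonzero.
field; nonzero.
Qed.

Lemma pi1_Fg : pi1 Fg = (k2 * Fg)^-1 * (n1 * n2 / ((1 - n1 * g) * (1 - n2 * g))).
Proof.
rewrite /Fg !rmE !pi1E.
have -> : n1 * n2 * (1 - f * g) / (k2 * D1) * (k2 * g) - 1
  = - f * (1 - n1 * g) * (1 - n2 * g) / D1.
  by rewrite /D1; field; nonzero.
by field; nonzero.
Qed.

Definition half_step : {rmorphism F -> F} :=
  pi1 \o pi2 \o s4 \o s5 \o s3 \o s6 \o s4 \o s3 \o s0 \o s6.

(** The permutations fix [G]. They move the factors contributed by the two [s6], so that before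
    [pi2] the zeros in f are n3, n4 and the poles k1/n7, k1/n8. Then [pi2] turns [G] into [Fg] and f
    into g, and [pi1] adds the poles at 1/n1 and 1/n2 through [pi1_Fg]. *)
Lemma half_step_G : half_step G = (k2 * Fg)^-1 *
  (n1 * n2 * n3 * n4 * (n5 - k2 * g) * (n6 - k2 * g)
   / (k2 ^+ 2 * ((1 - n1 * g) * (1 - n2 * g) * (1 - n3 * g) * (1 - n4 * g)))).
Proof.
rewrite /half_step /= s6_G.
have s0G : s0 G = G by rewrite /G !rmE !s0E.
have s3G : s3 G = G by rewrite /G !rmE !s3E.
have s4G : s4 G = G by rewrite /G !rmE !s4E.
have s5G : s5 G = G by rewrite /G !rmE !s5E.
have pi2G : pi2 G = Fg by rewrite /G /Fg !rmE !pi2E [g * f]mulrC.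
rewrite !(rmE, s0E, s3E, s4E, s5E, s6E, pi1E, pi2E,
  s0G, s3G, s4G, s5G, pi2G, s6_G, pi1_Fg).
rewrite !div1r !invrK.
have factor c : k2 - c * (k2 * g) = k2 * (1 - c * g) by ring.
by rewrite !factor; field; nonzero.
Qed.

(** The image of [k2] under w. *)
Let c := k1 * k2 ^+ 3 / (n1 * n2 * n3 * n4 * n5 * n6).

Let halfE :
  [/\ [/\ half_step n1 = k2 / n4, half_step n2 = k2 / n3,
          half_step n3 = k2 / n2 & half_step n4 = k2 / n1],
      [/\ half_step n5 = n8, half_step n6 = n7,
          half_step n7 = k2 / n5 & half_step n8 = k2 / n6]
    & [/\ half_step k1 = k2, half_step k2 = c & half_step f = k2 * g]].
Proof.
rewrite /half_step /c /=; split; split;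
  rewrite !(rmE, s0E, s3E, s4E, s5E, s6E, pi1E, pi2E) ?(div1r, invrK) //.
all: by field; nonzero.
Qed.

Let A := Fg * (k2 ^+ 2 * ((1 - n1 * g) * (1 - n2 * g) * (1 - n3 * g) * (1 - n4 * g))
  / (n1 * n2 * n3 * n4 * (n5 - k2 * g) * (n6 - k2 * g))).

Lemma half_step_Vg : half_step g^-1 = k2 * (g - A).
Proof.
have -> : g^-1 = f - G^-1 by rewrite /G; field; nonzero.
have [_ _ [_ _ half_f]] := halfE.
rewrite rmorphB fmorphV half_step_G half_f /A [RHS]mulrBr; congr (_ - _).
by rewrite invfM invrK invf_div !mulrA.
Qed.

(** The products f g and n_i g (i = 1, ..., 4) are invariant under Xi; [Fg] is scaled by s and the
    cofactor by s^-2. *)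
Lemma Xi_A : Xi A = A / s.
Proof.
have sV : s / s = 1 by rewrite divff.
have Xi_Fg : Xi Fg = s * Fg.
  by rewrite /Fg !rmE !XiE mulrACA sV mulr1 [f * s]mulrC mulrA.
have Xi_1B x : Xi x = x * s -> Xi (1 - x * g) = 1 - x * g.
  by move=> Xix; rewrite !rmE !XiE Xix mulrACA sV mulr1.
have Xi_5 : Xi (n5 - k2 * g) = k1 / (q * k2) * (n5 - k2 * g).
  by rewrite !rmE !XiE /s; field; nonzero.
have Xi_6 : Xi (n6 - k2 * g) = k1 / (q * k2) * (n6 - k2 * g).
  by rewrite !rmE !XiE /s; field; nonzero.
have Xi_k2 : Xi k2 = k1 * s / q by rewrite XiE /s; field; nonzero.
rewrite /A; move: (Fg) Xi_Fg => F0 Xi_F0.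
rewrite !(rmorphM, rmorphXn, fmorphV) Xi_F0 Xi_5 Xi_6 Xi_k2 !Xi_1B ?XiE //.
by field; nonzero.
Qed.

Definition evolution : {rmorphism F -> F} := Xi \o half_step \o half_step.
Local Notation T := evolution.

Let evolutionE x : T x = Xi (half_step (half_step x)).
Proof. by []. Qed.

Lemma evolution_params :
  [/\ [/\ T n1 = n1, T n2 = n2, T n3 = n3 & T n4 = n4],
      [/\ T n5 = n5, T n6 = n6, T n7 = n7 & T n8 = n8]
    & T k1 = k1 / q /\ T k2 = q * k2].
Proof.
have [[h1 h2 h3 h4] [h5 h6 h7 h8] [h9 h10 h11]] := halfE.
pose hE := (h1, h2, h3, h4, h5, h6, h7, h8, h9, h10, h11).
split; split; rewrite evolutionE.
all: rewrite !hE /c; rewrite ?(rmorphM, rmorphXn, fmorphV, hE) /c.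
all: rewrite ?(rmorphM, rmorphXn, fmorphV, XiE) /s /q.
all: by field; nonzero.
Qed.

Let b := Xi c.

(** The factor [b] in T f and the factor Xi k2 in the image of 1/w(g) differ by exactly the scale by
    which Xi divides g and [A]. *)
Let Xi_k2 : Xi k2 = b * s.
Proof. by rewrite /b /c !(rmorphM, rmorphXn, fmorphV) !XiE /s /q; field; nonzero. Qed.

Let T_f : T f = b * Xi (half_step g).
Proof.
have [_ _ [_ h10 h11]] := halfE.
by rewrite evolutionE h11 !rmorphM h10.
Qed.

Lemma evolution_Vf : (T f)^-1 = g - A.
Proof.
rewrite T_f invfM -!fmorphV half_step_Vg rmorphM Xi_k2 rmorphB Xi_A XiE fmorphV -/b.
have bN0 : b != 0 by rewrite /b fmorph_eq0 /c; nonzero.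
by field; nonzero.
Qed.

Lemma evolution_f :
  (T f * g - 1) * (f * g - 1) / (T f * f)
    = (g - 1 / n1) * (g - 1 / n2) * (g - 1 / n3) * (g - 1 / n4)
      / ((g - n5 / k2) * (g - n6 / k2)).
Proof.
have TfN0 : T f != 0 by rewrite fmorph_eq0.
(* The left-hand side depends on T f only through g - 1/T f, which is [A]. *)
have -> : (T f * g - 1) * (f * g - 1) / (T f * f) = (g - (T f)^-1) / Fg.
  by rewrite /Fg; field; nonzero.
rewrite evolution_Vf subKr /A.
have E1 x : x != 0 -> g - 1 / x = - (1 - x * g) / x by move=> ?; field.
have E5 x : g - x / k2 = - (x - k2 * g) / k2 by field.
rewrite !E1 // !E5.
have FgN0 : Fg != 0 by rewrite /Fg; nonzero.
by field; nonzero.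
Qed.

(** Put U = Xi w. Applying U to [half_step_Vg] gives 1/T g = T f - b U(A). As U n_i = b / n_(5-i)
    for i = 1, ..., 4 and U g = T f / b, each 1 - n_i g becomes (n_(5-i) - T f) / n_(5-i), while n5
    and n6 go to T(k1/n7) and T(k1/n8), the poles of the right-hand side. *)
Lemma evolution_g :
  (T f * g - 1) * (T f * T g - 1) / (g * T g)
    = (T f - n1) * (T f - n2) * (T f - n3) * (T f - n4)
      / ((T f - T (k1 / n7)) * (T f - T (k1 / n8))).
Proof.
have [[h1 h2 h3 h4] [h5 h6 h7 h8] [h9 h10 h11]] := halfE.
have bN0 : b != 0 by rewrite /b fmorph_eq0 /c; nonzero.
have TfN0 : T f != 0 by rewrite fmorph_eq0.
have TgN0 : T g != 0 by rewrite fmorph_eq0.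
have Ug : Xi (half_step g) = T f / b by rewrite T_f mulrC mulKf.
have TVg : (T g)^-1 = T f - b * Xi (half_step A).
  rewrite -(fmorphV T) (evolutionE g^-1) half_step_Vg rmorphM h10 rmorphM.
  rewrite (rmorphB half_step) (rmorphB Xi) Ug mulrBr.
  by rewrite -/b mulrCA divff // mulr1.
have UFg : Xi (half_step Fg) = b * g / (T f * g - 1).
  have Uf : Xi (half_step f) = b * g by rewrite h11 rmorphM Xi_k2 XiE; field; nonzero.
  by rewrite /Fg !rmE Uf Ug; congr (_ / (_ - 1)); field; nonzero.
(* Division by 0 gives 0, so the nonzero value U(Fg) has a nonzero denominator. *)
have Tfg1 : T f * g - 1 != 0.
  suff : Xi (half_step Fg) != 0 by rewrite UFg !mulf_eq0 invr_eq0 !negb_or => /andP[].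
  by rewrite !fmorph_eq0 /Fg; nonzero.
have Un x y : y != 0 -> half_step x = k2 / y -> Xi y = y * s ->
    Xi (half_step x) = b / y.
  by move=> yN0 -> Xiy; rewrite rmorphM fmorphV Xi_k2 Xiy; field; nonzero.
have Un1 := Un _ _ n4N0 h1 XiE.1.1.2.
have Un2 := Un _ _ n3N0 h2 XiE.1.1.1.2.
have Un3 := Un _ _ n2N0 h3 XiE.1.1.1.1.2.
have Un4 := Un _ _ n1N0 h4 XiE.1.1.1.1.1.
have U1B x y : y != 0 -> Xi (half_step x) = b / y ->
    Xi (half_step (1 - x * g)) = (y - T f) / y.
  by move=> yN0 Ux; rewrite !rmE Ux Ug; field; nonzero.
have Uk2 : Xi (half_step k2) = b by rewrite h10.
have UB x z : Xi (half_step x) = z -> Xi (half_step (x - k2 * g)) = z - T f.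
  by move=> Ux; rewrite !rmE Ux Uk2 Ug [b * _]mulrC divfK.
have [_ [_ _ T7 T8] [Tk1 _]] := evolution_params.
have Un5 : Xi (half_step n5) = T (k1 / n7).
  by rewrite h5 !rmE T7 Tk1 !XiE; field; nonzero.
have Un6 : Xi (half_step n6) = T (k1 / n8).
  by rewrite h6 !rmE T8 Tk1 !XiE; field; nonzero.
have bUA : b * Xi (half_step A) = g / (T f * g - 1) *
    ((T f - n1) * (T f - n2) * (T f - n3) * (T f - n4)
     / ((T f - T (k1 / n7)) * (T f - T (k1 / n8)))).
  move: (T (k1 / n7)) (T (k1 / n8)) Un5 Un6 => t7 t8 U5 U6.
  have TfB7 : t7 - T f != 0 by rewrite -(UB _ _ U5) !fmorph_eq0.
  have TfB8 : t8 - T f != 0 by rewrite -(UB _ _ U6) !fmorph_eq0.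
  rewrite /A; move: (Fg) UFg => F0 UF0.
  rewrite !(rmorphM, rmorphXn, fmorphV) UF0 (UB _ _ U5) (UB _ _ U6).
  rewrite (U1B _ _ n4N0 Un1) (U1B _ _ n3N0 Un2) (U1B _ _ n2N0 Un3) (U1B _ _ n1N0 Un4).
  rewrite Un1 Un2 Un3 Un4 Uk2 -[T f - t7]opprB -[T f - t8]opprB.
  move: (T f) Tfg1 TfB7 TfB8 => t tg1 tB7 tB8; move: b bN0 => b' b'N0.
  by field; nonzero.
have -> : (T f * g - 1) * (T f * T g - 1) / (g * T g)
    = (T f * g - 1) / g * (T f - (T g)^-1) by field; nonzero.
by rewrite TVg subKr bUA -[X in X * _ = _]invf_div mulKf //; nonzero.
Qed.

Variable S : {rmorphism F -> F}.
Hypothesis S_X : forall i, S (tnth X i) = tnth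
  [tuple s * n1; s * n2; s * n3; s * n4; s^-1 * n5; s^-1 * n6;
    s^-1 * n7; s^-1 * n8; k1; k2; s * f; s^-1 * g] i.

(** Xi does not simply scale n5, ..., n8; the extra factors cancel in the quotients by [k2] or
    [k1]. *)
Lemma Xi_scaling x :
  x \in [:: n1; n2; n3; n4; n5 / k2; n6 / k2; n7 / k1; n8 / k1; f; g] ->
  Xi x = S x.
Proof.
have SE := images S_X; move: x.
suff /allP scaling : all (fun x => Xi x == S x)
    [:: n1; n2; n3; n4; n5 / k2; n6 / k2; n7 / k1; n8 / k1; f; g].
  by move=> x /scaling/eqP.
have eqT (x y : F) : x = y -> x == y by move/eqP.
rewrite /= !(rmorphM, fmorphV) !XiE !SE /s /q.
by repeat (apply/andP; split); rewrite //; apply: eqT; field; nonzero.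
Qed.

End Evolution.

End Coordinates.

(** * Substitutions in rational functions *)

Section Substitution.

Variable k : fieldType.
Local Notation K := (ratfun k).

(* Stating facts over this packed field keeps unification off the concrete        *)
(* construction of fractions, which is very slow to compare.                      *)
Definition ratfield : fieldType := K.

Definition eval (v : 12.-tuple K) : {rmorphism {mpoly k[12]} -> ratfield} :=
  mmap (@FracField.tofrac _ \o @mpolyC 12 k) (tnth v).

Lemma subst_polyE v p : subst_poly v p = eval v p.
Proof. by []. Qed.

Lemma substE v : subst v =1 fraction_map (eval v).
Proof. by move=> r; rewrite /fraction_map -2!subst_polyE. Qed.

Lemma specializes_eval_partial u :
  @partial_morphism ratfield ratfield (specializes (eval u)).
Proof. exact: specializes_partial. Qed.

Lemma eval_var u i : eval u 'X_i = tnth u i.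
Proof. exact: etrans (mmapX _ _ _) (mmap1U _ _). Qed.

Lemma eval_const u a : eval u a%:MP = FracField.tofrac a%:MP.
Proof. exact: mmapC. Qed.

Lemma specializes_var u i : specializes (eval u) (var k i) (tnth u i).
Proof. exact: (specializes_tofrac (eval_var u i)). Qed.

Lemma specializes_const u a :
  specializes (eval u) (FracField.tofrac a%:MP) (FracField.tofrac a%:MP).
Proof. exact: (specializes_tofrac (eval_const u a)). Qed.

Lemma tofrac_inj0 (p : {mpoly k[12]}) : FracField.tofrac p = 0 -> p = 0.
Proof. by move/eqP; rewrite tofrac_eq0 => /eqP. Qed.

Lemma eval_inj u v : (forall i, specializes (eval u) (tnth v i) (var k i)) ->
  forall p, eval v p = 0 -> p = 0.
Proof.
exact: (@mmap_inj 12 k ratfield (@FracField.tofrac {mpoly k[12]}) _ (tnth v) tofrac_inj0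
  (specializes_eval_partial u) (specializes_const u)).
Qed.

Definition vars : 12.-tuple ratfield :=
  [tuple nu1; nu2; nu3; nu4; nu5; nu6; nu7; nu8; kappa1; kappa2; f; g].

Lemma tnth_vars i : tnth vars i = var k i.
Proof.
case: i => m lt_m; rewrite (tnth_nth (nu1 : ratfield)).
by do 12?[case: m lt_m => [|m] lt_m //].
Qed.

Lemma specializes_vars u i : specializes (eval u) (tnth vars i) (tnth u i).
Proof. by rewrite tnth_vars; apply: specializes_var. Qed.

Section Morphism.
Variables (u v : 12.-tuple ratfield) (phi : K -> K).
Hypothesis uv : forall i, specializes (eval u) (tnth v i) (tnth vars i).
Hypothesis phiE : phi =1 subst v.

Let v_inj p : eval v p = 0 -> p = 0.
Proof.
move: p; apply: (@eval_inj u) => i.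
by have := uv i; rewrite tnth_vars.
Qed.

Lemma subst_is_zmod_morphism : zmod_morphism (phi : ratfield -> ratfield).
Proof.
by move=> x y; rewrite !phiE !substE; apply: (fraction_map_is_zmod_morphism v_inj).
Qed.

Lemma subst_is_monoid_morphism : monoid_morphism (phi : ratfield -> ratfield).
Proof.
have [map1 mapM] := fraction_map_is_monoid_morphism v_inj.
by split=> [|x y]; rewrite !phiE !substE; [apply: map1 | apply: mapM].
Qed.

(** The underlying function is [phi] itself, so each packed morphism remains the named operator. *)
Definition subst_rmorphism : {rmorphism ratfield -> ratfield} :=
  HB.pack (phi : ratfield -> ratfield)
    (GRing.isZmodMorphism.Build ratfield ratfield phi subst_is_zmod_morphism)
    (GRing.isMonoidMorphism.Build ratfield ratfield phi subst_is_monoid_morphism).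

Lemma subst_vars i : subst_rmorphism (tnth vars i) = tnth v i.
Proof.
rewrite [LHS]phiE substE; apply: (fraction_mapE v_inj).
exact: specializes_vars.
Qed.

Lemma subst_const a :
  subst_rmorphism (FracField.tofrac a%:MP) = FracField.tofrac a%:MP.
Proof.
by rewrite [LHS]phiE substE; apply: (fraction_mapE v_inj); apply: specializes_const.
Qed.

End Morphism.

Lemma vars_neq0 i : tnth vars i != 0.
Proof.
rewrite tnth_vars; apply: contra_neq (_ : 'X_i != 0 :> {mpoly k[12]}).
  exact: tofrac_inj0.
by rewrite -msize_poly_eq0 msizeX.
Qed.

Let vars_f0 : 12.-tuple ratfield :=
  [tuple nu1; nu2; nu3; nu4; nu5; nu6; nu7; nu8; kappa1; kappa2; 0; g].
Let vars_g0 : 12.-tuple ratfield :=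
  [tuple nu1; nu2; nu3; nu4; nu5; nu6; nu7; nu8; kappa1; kappa2; f; 0].

Lemma generic_vars : @generic_coordinates ratfield
  nu1 nu2 nu3 nu4 nu5 nu6 nu7 nu8 kappa1 kappa2 f g.
Proof.
exact: (specializations_generic vars_neq0
  (specializes_eval_partial vars_f0) (specializes_eval_partial vars_g0)
  (specializes_vars vars_f0) (specializes_vars vars_g0)).
Qed.

(** * The operators as field endomorphisms, and their values on the variables *)

Definition s0_inverse := s0_involution (@specializes_vars _).
Definition s3_inverse := s3_involution (@specializes_vars _).
Definition s4_inverse := s4_involution (@specializes_vars _).
Definition s5_inverse := s5_involution (@specializes_vars _).
Definition s6_inverse :=
  s6_involution generic_vars (specializes_eval_partial _) (@specializes_vars _).
Definition pi1_inverse :=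
  pi1_involution generic_vars (specializes_eval_partial _) (@specializes_vars _).
Definition pi2_inverse :=
  pi2_involution generic_vars (specializes_eval_partial _) (@specializes_vars _).
Definition Xi_right_inverse :=
  Xi_inverse generic_vars (specializes_eval_partial _) (@specializes_vars _).
Definition S_E6_inverse :=
  S_E6_involution generic_vars (specializes_eval_partial _) (@specializes_vars _).

(** Reads the tuple off the type of the proof that it is inverted, which avoids writing it again. *)
Definition inverted_tuple u (v : 12.-tuple ratfield)
  (_ : forall i, specializes (eval u) (tnth v i) (tnth vars i)) := v.

(* Unfolding [q] and [xi_scale] first spares the kernel an expensive comparison. *)
Lemma Xi_subst : @Xi k =1 subst (inverted_tuple Xi_right_inverse).
Proof. by move=> r; rewrite /Xi /xi_scale /q /inverted_tuple. Qed.

Definition s0_morphism : {rmorphism ratfield -> ratfield} :=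
  subst_rmorphism (phi := @s0 k) s0_inverse (fun=> erefl).
Definition s3_morphism : {rmorphism ratfield -> ratfield} :=
  subst_rmorphism (phi := @s3 k) s3_inverse (fun=> erefl).
Definition s4_morphism : {rmorphism ratfield -> ratfield} :=
  subst_rmorphism (phi := @s4 k) s4_inverse (fun=> erefl).
Definition s5_morphism : {rmorphism ratfield -> ratfield} :=
  subst_rmorphism (phi := @s5 k) s5_inverse (fun=> erefl).
Definition s6_morphism : {rmorphism ratfield -> ratfield} :=
  subst_rmorphism (phi := @s6 k) s6_inverse (fun=> erefl).
Definition pi1_morphism : {rmorphism ratfield -> ratfield} :=
  subst_rmorphism (phi := @pi1 k) pi1_inverse (fun=> erefl).
Definition pi2_morphism : {rmorphism ratfield -> ratfield} :=
  subst_rmorphism (phi := @pi2 k) pi2_inverse (fun=> erefl).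
Definition Xi_morphism : {rmorphism ratfield -> ratfield} :=
  subst_rmorphism Xi_right_inverse Xi_subst.
Definition S_E6_morphism : {rmorphism ratfield -> ratfield} :=
  subst_rmorphism (phi := S_E6 (nu5 * nu6 / kappa2)) S_E6_inverse (fun=> erefl).

Definition s0_vars : forall i, s0_morphism (tnth vars i) = _ :=
  subst_vars s0_inverse _.
Definition s3_vars : forall i, s3_morphism (tnth vars i) = _ :=
  subst_vars s3_inverse _.
Definition s4_vars : forall i, s4_morphism (tnth vars i) = _ :=
  subst_vars s4_inverse _.
Definition s5_vars : forall i, s5_morphism (tnth vars i) = _ :=
  subst_vars s5_inverse _.
Definition s6_vars : forall i, s6_morphism (tnth vars i) = _ :=
  subst_vars s6_inverse _.
Definition pi1_vars : forall i, pi1_morphism (tnth vars i) = _ :=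
  subst_vars pi1_inverse _.
Definition pi2_vars : forall i, pi2_morphism (tnth vars i) = _ :=
  subst_vars pi2_inverse _.
Definition Xi_vars : forall i, Xi_morphism (tnth vars i) = _ :=
  subst_vars Xi_right_inverse _.
Definition S_E6_vars : forall i, S_E6_morphism (tnth vars i) = _ :=
  subst_vars S_E6_inverse _.

Definition w_morphism := half_step s0_morphism s3_morphism s4_morphism s5_morphism
  s6_morphism pi1_morphism pi2_morphism.
Definition T_morphism := evolution s0_morphism s3_morphism s4_morphism s5_morphism
  s6_morphism pi1_morphism pi2_morphism Xi_morphism.

Lemma w_morphismE x : w_morphism x = w x.
Proof. by rewrite /w_morphism /half_step /w. Qed.

Lemma T_morphismE x : T_morphism x = T x.
Proof.
rewrite /T_morphism /evolution /T.
exact: (congr1 (@Xi k) (etrans (w_morphismE _) (congr1 _ (w_morphismE _)))).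
Qed.

Definition T_params := evolution_params generic_vars s0_vars s3_vars s4_vars s5_vars
  s6_vars pi1_vars pi2_vars Xi_vars.
Definition T_f_equation := evolution_f generic_vars s0_vars s3_vars s4_vars s5_vars
  s6_vars pi1_vars pi2_vars Xi_vars.
Definition T_g_equation := evolution_g generic_vars s0_vars s3_vars s4_vars s5_vars
  s6_vars pi1_vars pi2_vars Xi_vars.

(** The elements on which two field endomorphisms agree form a subfield. *)
Lemma generated_agree (a b : {rmorphism ratfield -> ratfield}) (G : seq K) :
  (forall c : k, a (FracField.tofrac c%:MP) = b (FracField.tofrac c%:MP)) ->
  (forall x, x \in G -> a x = b x) -> forall x, generated G x -> a x = b x.
Proof.
move=> ab_const ab_G x.
elim=> {x} [c|x|x y _ abx _ aby|x _ abx|x y _ abx _ aby|x _ abx].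
- exact: ab_const.
- exact: ab_G.
- exact: (etrans (rmorphD a x y) (etrans (congr2 _ abx aby) (esym (rmorphD b x y)))).
- exact: (etrans (rmorphN a x) (etrans (congr1 _ abx) (esym (rmorphN b x)))).
- exact: (etrans (rmorphM a x y) (etrans (congr2 _ abx aby) (esym (rmorphM b x y)))).
- exact: (etrans (fmorphV a x) (etrans (congr1 _ abx) (esym (fmorphV b x)))).
Qed.

Lemma Xi_S_E6 (zeta : K) :
  generated E6_generators zeta -> Xi zeta = S_E6 (nu5 * nu6 / kappa2) zeta.
Proof.
apply: (@generated_agree Xi_morphism S_E6_morphism) => [c|].
  exact: (etrans (subst_const Xi_right_inverse _ c)
    (esym (subst_const S_E6_inverse _ c))).
exact: (Xi_scaling generic_vars Xi_vars S_E6_vars).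
Qed.

End Substitution.

Theorem theorem3p1 (k : fieldType) :
  [/\ (T f * g - 1) * (f * g - 1) / (T f * f)
        = (g - 1 / nu1) * (g - 1 / nu2) * (g - 1 / nu3) * (g - 1 / nu4)
          / ((g - nu5 / kappa2) * (g - nu6 / kappa2)) :> ratfun k,
      (T f * g - 1) * (T f * T g - 1) / (g * T g)
        = (T f - nu1) * (T f - nu2) * (T f - nu3) * (T f - nu4)
          / ((T f - T (kappa1 / nu7)) * (T f - T (kappa1 / nu8)))
          :> ratfun k,
      [/\ T nu1 = nu1 :> ratfun k, T nu2 = nu2 :> ratfun k,
          T nu3 = nu3 :> ratfun k & T nu4 = nu4 :> ratfun k]
      /\ [/\ T nu5 = nu5 :> ratfun k, T nu6 = nu6 :> ratfun k,
             T nu7 = nu7 :> ratfun k & T nu8 = nu8 :> ratfun k],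
      T kappa1 = kappa1 / q :> ratfun k /\ T kappa2 = q * kappa2 :> ratfun k
    & forall zeta : ratfun k, generated E6_generators zeta ->
        Xi zeta = S_E6 (nu5 * nu6 / kappa2) zeta].
Proof.
have [[t1 t2 t3 t4] [t5 t6 t7 t8] [t9 t10]] := T_params k.
rewrite -!T_morphismE.
split.
- exact: (T_f_equation k).
- exact: (T_g_equation k).
- by split; split.
- by split.
- exact: Xi_S_E6.
Qed.
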